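(* For every graph $X$, $$\mathrm{mdeg}(X)\geq \mathrm{clique}(X)\quad\text{and}\quad \mathrm{mdeg}(X)\geq\mathrm{girth}(X),$$ where $\mathrm{clique}(X)$ is the clique number of $X$ (the largest cardinality of a clique of $X$) and $\mathrm{girth}(X)$ is the girth of $X$ (the length of a shortest cycle of $X$). As a consequence, for every $n\geq 1$, the complete graph $K_n$ with $n$ vertices and the cycle $C_n$ of length $n$ have median degree $n$.
   Context: Graphs are simple and undirected. A connected graph $M$ with graph metric $d$ is median if for all vertices $x_1,x_2,x_3$ there is a unique vertex $m$ with $d(x_i,x_j)=d(x_i,m)+d(m,x_j)$ for all $i\neq j$. Two edges $\{a,b\},\{x,y\}$ of a connected graph are in $\Theta$-relation if $d(a,x)+d(b,y)\neq d(a,y)+d(b,x)$. In a median graph $\Theta$ is an equivalence relation on edges, the reflexive-transitive closure of ''being opposite edges of a square'' (square = induced 4-cycle). Two distinct $\Theta$-classes cross if they both contain an edge of a common square. The crossing graph $\mathrm{Cross}(M)$ has as vertices the $\Theta$-classes of $M$, two $\Theta$-classes being adjacent when they cross. The degree of a graph is the (possibly infinite) supremum of the degrees of its vertices. The median degree $\mathrm{mdeg}(X)$ of a graph $X$ is the smallest degree of a median graph $M$ with $\mathrm{Cross}(M)\simeq X$ (it is known that such an $M$ always exists).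
   Formalization: The girth inequality is stated for graphs X containing a cycle, since otherwise the girth is undefined (and with girth = ∞ the claim fails for a single vertex); C_1 and C_2 are read as the simple graphs K_1 and K_2. *)

(* Defs.v *)
From HB Require Import structures.
From mathcomp Require Import all_boot all_order all_algebra.
From mathcomp Require Import all_classical all_reals all_analysis.
Set Implicit Arguments.
Unset Strict Implicit.
Unset Printing Implicit Defensive.
Import Order.TTheory GRing.Theory Num.Theory.
Local Open Scope classical_set_scope.
Local Open Scope ereal_scope.

(* Simple undirected graphs, possibly infinite or empty. *)
Record graph := Graph {
  vertex :> choiceType;
  adj : rel vertex;
  adj_sym : symmetric adj;
  adj_irr : irreflexive adj }.

Definition graph_iso (X Y : graph) : Prop :=
  exists f : X -> Y, bijective f /\ {mono f : x y / adj x y}.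

Section Metric.
Variable G : graph.

Definition walk (x y : G) (n : nat) : Prop :=
  exists p : seq G, [/\ path (@adj G) x p, last x p = y & size p = n].

(* The empty graph is not connected. *)
Definition connected_graph : Prop :=
  (exists x : G, True) /\ forall x y : G, exists n, walk x y n.

(* The value is 0 for vertices in different components; the distance is only
   used in connected graphs. *)
Definition dist (x y : G) : nat :=
  match pselect (exists n, `[< walk x y n >]) with
  | left ex => ex_minn ex
  | right _ => 0%N
  end.

Definition median_of (x1 x2 x3 m : G) : Prop :=
  [/\ dist x1 x2 = (dist x1 m + dist m x2)%N,
      dist x1 x3 = (dist x1 m + dist m x3)%N
    & dist x2 x3 = (dist x2 m + dist m x3)%N].

Definition median_graph : Prop :=
  connected_graph /\ forall x1 x2 x3 : G, exists! m, median_of x1 x2 x3 m.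

End Metric.

Section CrossingGraph.
Variable M : graph.

Definition edges : set (set M) :=
  [set f | exists a b : M, adj a b /\ f = [set a; b]].

(* Exchanging a and b, or x and y, exchanges the two sums, so the condition
   depends only on the unordered edges. *)
Definition Theta (f g : set M) : Prop :=
  exists a b x y : M,
    [/\ adj a b, adj x y, f = [set a; b], g = [set x; y]
      & (dist a x + dist b y)%N <> (dist a y + dist b x)%N].

(* These are equivalence classes as soon as Theta is an equivalence relation
   on edges, in particular when M is median. *)
Definition Theta_classes : set (set (set M)) :=
  [set C | exists2 f, f \in edges & C = [set g | g \in edges /\ Theta f g]].

Definition square (a b c d : M) : bool :=
  [&& adj a b, adj b c, adj c d, adj d a,
      a != c, b != d, ~~ adj a c & ~~ adj b d].

Definition square_edges (a b c d : M) : set (set M) :=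
  [set [set a; b]; [set b; c]; [set c; d]; [set d; a]].

Definition cross (C D : set (set M)) : Prop :=
  C <> D /\ exists a b c d : M,
    [/\ square a b c d, C `&` square_edges a b c d !=set0
      & D `&` square_edges a b c d !=set0].

Definition cross_adj (C D : Theta_classes) : bool := `[< cross (val C) (val D) >].

Lemma cross_adj_sym : symmetric cross_adj.
Proof.
move=> C D; apply: asbool_equiv_eq.
by split=> -[neq [a [b [c [d [sq hC hD]]]]]];
  (split; [exact: nesym | exists a, b, c, d]).
Qed.

Lemma cross_adj_irr : irreflexive cross_adj.
Proof. by move=> C; apply/negbTE/asboolPn => -[]. Qed.

Definition Cross : graph := Graph cross_adj_sym cross_adj_irr.

End CrossingGraph.

Section Invariants.
(* Degrees, clique numbers and girths are elements of {0, 1, 2, ...} U {+oo},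
   viewed inside \bar R. *)
Variable R : realType.

Definition vertex_degree (G : graph) (x : G) : \bar R :=
  counting [set y | adj x y].

Definition degree (G : graph) : \bar R :=
  ereal_sup (range (@vertex_degree G)).

(* The set of degrees is nonempty for every X and consists of natural numbers
   and +oo, so the infimum is a minimum. *)
Definition mdeg (X : graph) : \bar R :=
  ereal_inf [set r | exists M : graph,
    [/\ median_graph M, graph_iso (Cross M) X & r = degree M]].

Definition clique (X : graph) (K : set X) : Prop :=
  forall x y : X, K x -> K y -> x <> y -> adj x y.

Definition clique_number (X : graph) : \bar R :=
  ereal_sup [set counting K | K in @clique X].

Definition is_cycle (X : graph) (c : seq X) : bool :=
  [&& (3 <= size c)%N, uniq c & cycle (@adj X) c].

(* The girth of an acyclic graph is +oo. *)
Definition girth (X : graph) : \bar R :=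
  ereal_inf [set (size c)%:R%:E | c in [set c : seq X | is_cycle c]].

End Invariants.

Section CompleteAndCycleGraphs.
Variable n : nat.

Definition complete_adj (i j : 'I_n) : bool := i != j.

Lemma complete_adj_sym : symmetric complete_adj.
Proof. by move=> i j; rewrite /complete_adj eq_sym. Qed.

Lemma complete_adj_irr : irreflexive complete_adj.
Proof. by move=> i; rewrite /complete_adj eqxx. Qed.

Definition complete_graph : graph := Graph complete_adj_sym complete_adj_irr.

(* The simple graph underlying the cycle of length n: a single vertex for
   n = 1 and a single edge for n = 2. *)
Definition cycle_adj (i j : 'I_n) : bool :=
  (i != j) && ((j == ordS i) || (i == ordS j)).

Lemma cycle_adj_sym : symmetric cycle_adj.
Proof. by move=> i j; rewrite /cycle_adj eq_sym orbC. Qed.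

Lemma cycle_adj_irr : irreflexive cycle_adj.
Proof. by move=> i; rewrite /cycle_adj eqxx. Qed.

Definition cycle_graph : graph := Graph cycle_adj_sym cycle_adj_irr.

End CompleteAndCycleGraphs.

(* Main.v *)
Require Import Defs.
From mathcomp Require Import all_boot all_order all_algebra.
From mathcomp Require Import all_classical all_reals all_analysis.
From mathcomp Require Import finmap zify.
Import Order.TTheory GRing.Theory Num.Theory.

Set Implicit Arguments.
Unset Strict Implicit.
Unset Printing Implicit Defensive.

Local Open Scope classical_set_scope.

(** Let [M] be a median graph.  Call a Theta-class of [M] carried by a vertex
    when it contains an edge at this vertex, and call carrier of a class the set
    of vertices that carry it.
    Distinct classes use distinct edges, so a vertex carrying [k] classes has
    degree at least [k] ([carriers_le_degree]).  Both lower bounds thus ask for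
    one vertex of [M] that carries all the vertices of a clique, or of some
    shortest cycle, of the crossing graph.

    Such a vertex is found by minimising over [u] the sum of the distances from
    [u] to the carriers of the classes under consideration.  Suppose that [u]
    does not carry the class [C], and let [uv] be the first edge of a geodesic
    from [u] to the carrier of [C], with class [D].  The carrier of [C] lies
    entirely beyond [D], on the side of [v], and moving from [u] to [v] lowers
    the distance to it ([separating_edge]).  It does not raise the distance to
    any carrier, except those lying behind [D], that is, entirely on the side
    of [u] ([cdist_step_le]).  A class that is neither beyond nor behind [D] is
    [D] or crosses [D] ([not_separated_cross]), and two crossing classes share
    a vertex of their carriers, so one cannot be beyond [D] and the other
    behind.

    In a clique no class is then behind [D], and moving to [v] contradicts
    minimality ([clique_common_carrier]).  In a shortest cycle, if some class is
    behind [D], then [D] or classes crossing [D] must separate it on the cycle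
    from [C] on both sides; routing the cycle through [D] bypasses the arc
    containing this class.  Since the cycle was shortest, the arc is reduced to
    one class, which [D] replaces, giving another shortest cycle; together with
    the move to [v] this lowers the sum ([cycle_descent]).  So the minimum is
    taken over the pairs of a vertex and a shortest cycle.

    The geometry rests on two facts.  A median graph contains no [K_{2,3}], so
    opposite edges of a square bound the same halfspaces; and by the quadrangle
    condition every edge leaving a halfspace is joined to any given edge that
    bounds it by a ladder of squares, so it bounds this halfspace too
    ([ladder_side]).  This describes Theta-classes as sets of edges leaving a
    halfspace, and makes halfspaces and carriers convex.

    For the upper bounds, the cliques of a finite graph [X], two of them being
    adjacent when they differ by one vertex of [X], form a median graph: the
    distance is the Hamming distance and the median is the majority, which is
    again a clique.  Labelling each edge by the vertex of [X] that it adds or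
    removes identifies the Theta-classes with the vertices of [X], and crossing
    with adjacency in [X].  The edges at a clique have distinct labels, so the
    degree is at most the number of vertices of [X] ([mdeg_le_card]).  For
    [K_n] and for [C_n] this number is [n], which the clique number reaches for
    [K_n] and for [C_n] with [n <= 2], and the girth for [C_n] with [n >= 3]. *)

(** * Distances in a connected graph *)

Section ConnectedDistance.
Variable G : graph.
Hypothesis conG : connected_graph G.
Implicit Types x y z : G.

Lemma walk_dist x y : walk x y (dist x y).
Proof.
rewrite /dist; case: pselect => [ex|[]]; first by case: ex_minnP => m /asboolP.
by have [n w] := conG.2 x y; exists n; apply/asboolP.
Qed.

Lemma dist_le_walk x y n : walk x y n -> dist x y <= n.
Proof.
move=> w; rewrite /dist; case: pselect => // ex.
by case: ex_minnP => m _; apply; apply/asboolP.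
Qed.

Lemma walk_cat x y z m n : walk x y m -> walk y z n -> walk x z (m + n).
Proof.
move=> [p [px lp <-]] [q [qy lq <-]]; exists (p ++ q).
by rewrite cat_path last_cat size_cat lp px qy lq.
Qed.

Lemma walk_rev x y n : walk x y n -> walk y x n.
Proof.
move=> [p [px <- <-]]; exists (rev (belast x p)); split.
- by rewrite rev_path; under eq_path do rewrite adj_sym.
- by case: p {px} => //= z p; rewrite rev_cons last_rcons.
- by rewrite size_rev size_belast.
Qed.

Lemma distC x y : dist x y = dist y x.
Proof.
by apply/eqP; rewrite eqn_leq !dist_le_walk//; apply/walk_rev/walk_dist.
Qed.

Lemma dist_triangle x y z : dist x z <= dist x y + dist y z.
Proof. by apply/dist_le_walk/walk_cat; apply: walk_dist. Qed.

Lemma distxx x : dist x x = 0.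
Proof. by apply/eqP; rewrite -leqn0 dist_le_walk//; exists [::]. Qed.

Lemma dist_eq0 x y : dist x y = 0 -> x = y.
Proof. by move=> d0; have [p] := walk_dist x y; rewrite d0 => -[_ <-]; case: p. Qed.

Lemma dist_eq1 x y : dist x y = 1 -> adj x y.
Proof.
move=> d1; have [p] := walk_dist x y; rewrite d1.
by case: p => [|z [|z' p]] [] //= /andP[xz _] <-.
Qed.

Lemma adj_dist x y : adj x y -> dist x y = 1.
Proof.
move=> xy; have : dist x y <= 1 by apply: dist_le_walk; exists [:: y] => /=; rewrite xy.
case e: (dist x y) => [|[|]] // _.
by move: xy; rewrite (dist_eq0 e) adj_irr.
Qed.

Lemma dist_step x y n :
  dist x y = n.+1 -> exists2 z, adj x z & dist z y = n.
Proof.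
move=> d; have [p] := walk_dist x y; rewrite d.
case: p => [|z p] [] //= /andP[xz pz] lp [sp]; exists z => //.
have le1 : dist z y <= n by apply: dist_le_walk; exists p.
have := dist_triangle x z y; rewrite (adj_dist xz); lia.
Qed.

End ConnectedDistance.

(** * Halfspaces of a median graph *)

Section MedianGraph.
Variable M : graph.
Hypothesis medM : median_graph M.
Implicit Types a b p q s t u v w x y z : M.

Let conM : connected_graph M := medM.1.
Let dC := distC conM.
Let dtri := dist_triangle conM.

Lemma median_uniq x y z m m' :
  median_of x y z m -> median_of x y z m' -> m = m'.
Proof. by have [n [_ u]] := medM.2 x y z => /u <- /u <-. Qed.

(** Median graphs are bipartite: the median of [x], [a] and [b] is one of the
    two endpoints of the edge. *)
Lemma adj_dist_neq x a b : adj a b -> dist x a <> dist x b.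
Proof.
move=> ab e; have [m [[h1 h2 h3] _]] := medM.2 x a b.
have := adj_dist conM ab; rewrite h3 => h.
have [ma|mb] : dist a m = 0 \/ dist m b = 0 by lia.
- have := dist_eq0 conM ma => ?; subst m; rewrite ma in h.
  by have := adj_dist conM ab; lia.
- have := dist_eq0 conM mb => ?; subst m.
  by have := adj_dist conM ab; have := dC a b; lia.
Qed.

Definition side a b x : bool := dist a x < dist b x.

Lemma side_dist a b x : adj a b ->
  if side a b x then dist b x = (dist a x).+1 else dist a x = (dist b x).+1.
Proof.
move=> ab; have := adj_dist_neq (x := x) ab; have := dtri a b x; have := dtri b a x.
rewrite /side (adj_dist conM ab) (dC b a) (adj_dist conM ab) (dC x a) (dC x b).
by case: ltnP; lia.
Qed.

Lemma sideN a b x : adj a b -> side b a x = ~~ side a b x.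
Proof.
by move=> ab; have := side_dist x ab; rewrite /side; case: ltnP => _ ->; lia.
Qed.

Lemma side_self a b : adj a b -> side a b a.
Proof. by move=> ab; rewrite /side distxx dC (adj_dist conM ab). Qed.

Lemma side_other a b : adj a b -> side a b b = false.
Proof. by move=> ab; rewrite /side distxx. Qed.

Lemma dist_fork x y z : adj x y -> adj x z -> y <> z -> dist y z = 2.
Proof.
move=> xy xz yz; have := dtri y x z; rewrite (dC y x) !(adj_dist conM xy, adj_dist conM xz).
case e: (dist y z) => [|[|[|]]] // _ //; first by have := dist_eq0 conM e.
by case: (adj_dist_neq (x := x) (dist_eq1 conM e)); rewrite !(adj_dist conM xy, adj_dist conM xz).
Qed.

(** The quadrangle condition: the new vertex is the median of [x], [y], [z]. *)
Lemma quadrangle w x y z n : adj w x -> adj w y -> x <> y ->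
  dist x z = n.+1 -> dist y z = n.+1 -> dist w z = n.+2 ->
  exists m, [/\ adj x m, adj y m & dist m z = n].
Proof.
move=> wx wy xy dx dy dw; have d2 := dist_fork wx wy xy.
have [m [[h1 h2 h3] _]] := medM.2 x y z.
have ym := dC y m; have e : dist x m = 1 /\ dist m y = 1 by lia.
by exists m; split; [apply: (dist_eq1 conM)..|]; lia.
Qed.

(** In a [K_{2,3}], both [x] and [y] would be medians of [p], [q] and [r]. *)
Lemma no_K23 x y p q r : x <> y -> p <> q -> p <> r -> q <> r ->
  adj x p -> adj x q -> adj x r -> adj y p -> adj y q -> adj y r -> False.
Proof.
move=> xy pq pr qr xp xq xr yp yq yr; case: (xy).
have dd := adj_dist conM.
have m v : adj v p -> adj v q -> adj v r -> median_of p q r v.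
  move=> vp vq vr; rewrite /median_of (dist_fork xp xq pq).
  by rewrite (dist_fork xp xr pr) (dist_fork xq xr qr) (dC p) (dC q) !dd.
by apply: (@median_uniq p q r); apply: m.
Qed.

(** If [z] were nearer to [x] than to [y], and to [y'] than to [x'], then [x]
    and [y'] would be equidistant from [z], and the quadrangle condition would
    give them a third common neighbour besides [y] and [x']. *)
Lemma square_side_sub x y y' x' z :
    adj x y -> adj y y' -> adj y' x' -> adj x' x -> x <> y' -> y <> x' ->
  side x y z -> side x' y' z.
Proof.
move=> xy yy' y'x' x'x xy' yx' sz; apply/negPn/negP => sz'.
have := side_dist z xy; rewrite sz => d1.
have x'y' : adj x' y' by rewrite adj_sym.
have := side_dist z x'y'; rewrite (negbTE sz') => d2.
have dd := adj_dist conM.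
have h1 := dtri x' x z; rewrite (dd _ _ x'x) in h1.
have h2 := dtri y y' z; rewrite (dd _ _ yy') in h2.
have e1 : dist y z = (dist x z).+1 by lia.
have e2 : dist y' z = dist x z by lia.
have dne : dist x z <> 0.
  move=> e0; apply: xy'; rewrite (dist_eq0 conM e0).
  by rewrite e0 in e2; rewrite (dist_eq0 conM e2).
have yx : adj y x by rewrite adj_sym.
have [m [xm y'm dm]] : exists m, [/\ adj x m, adj y' m & dist m z = (dist x z).-1].
  by apply: (@quadrangle y) => //; lia.
have xx' : adj x x' by rewrite adj_sym.
have y'y : adj y' y by rewrite adj_sym.
apply: (@no_K23 x y' y x' m) => // e; subst m; lia.
Qed.

Lemma square_side x y y' x' z :
    adj x y -> adj y y' -> adj y' x' -> adj x' x -> x <> y' -> y <> x' ->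
  side x y z = side x' y' z.
Proof.
move=> xy yy' y'x' x'x xy' yx'; apply/idP/idP; first exact: square_side_sub.
have ? : adj x' y' by rewrite adj_sym.
have ? : adj y' y by rewrite adj_sym.
have ? : adj y x by rewrite adj_sym.
have ? : adj x x' by rewrite adj_sym.
by apply: square_side_sub => //; apply: nesym.
Qed.

(** An edge leaving a halfspace of [ab] is joined to [ab] by a ladder of
    squares, built by descending towards [a] with the quadrangle condition. *)
Lemma ladder_side a b x y : adj a b -> adj x y -> side a b x -> ~~ side a b y ->
  side x y =1 side a b.
Proof.
move=> ab; move e: (dist a x) => n.
elim: n x y e => [|n IH] x y e xy sx sy z.
  have ax := dist_eq0 conM e; subst x.
  have := side_dist y ab; rewrite (negbTE sy) (adj_dist conM xy) => -[/esym by0].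
  by rewrite (dist_eq0 conM by0).
have := side_dist x ab; rewrite sx => dbx.
have := side_dist y ab; rewrite (negbTE sy) => day.
have h1 := dtri a x y; have h2 := dtri b y x.
rewrite (dC y x) (adj_dist conM xy) in h2; rewrite (adj_dist conM xy) in h1.
have dby : dist b y = n.+1 by lia.
have dxa : dist x a = n.+1 by rewrite dC.
have [x' xx' dx'] := dist_step conM dxa.
have dx'b : dist b x' = n.+1.
  have := dtri b a x'; rewrite (dC b a) (adj_dist conM ab) (dC a).
  by have := dtri b x' x; rewrite (dC x' x) (adj_dist conM xx'); lia.
have x'y : x' <> y by move=> ?; subst x'; have := dC a y; lia.
have [y' [x'y' yy' dy']] : exists m, [/\ adj x' m, adj y m & dist m b = n].
  by apply: (@quadrangle x); rewrite // dC; lia.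
have sx' : side a b x' by rewrite /side (dC a); lia.
have sy' : ~~ side a b y'.
  apply/negP => s; have := side_dist y' ab; rewrite s (dC b) dy' => e1.
  have := dtri a y' y; rewrite (dC y' y) (adj_dist conM yy') day dby; lia.
rewrite -(IH x' y') //; last by rewrite dC.
apply: square_side => //; [by rewrite adj_sym| by rewrite adj_sym| |exact: nesym].
by move=> ?; subst y'; move: sy'; rewrite sx.
Qed.

Lemma cut_side a b x y : adj a b -> adj x y -> side a b x != side a b y ->
  forall s t, (side a b s != side a b t) = (side x y s != side x y t).
Proof.
move=> ab xy; case sx: (side a b x); case sy: (side a b y) => //= _ s t.
  by rewrite !(ladder_side ab xy) ?sy.
have yx : adj y x by rewrite adj_sym.
have h := ladder_side ab yx sy (negbT sx).
by rewrite !(sideN _ yx) !h; case: (side a b s); case: (side a b t).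
Qed.

Lemma geodesic_exit (P : pred M) s t : P s -> ~~ P t ->
  exists x y, [/\ adj x y, P x, ~~ P y & dist s t = dist s x + (dist y t).+1].
Proof.
move e: (dist s t) => n; elim: n s e => [|n IH] s e Ps Pt.
  by move: Pt; rewrite -(dist_eq0 conM e) Ps.
have [s' ss' ds'] := dist_step conM e.
case: (boolP (P s')) => Ps'; last by exists s, s'; rewrite distxx; split=> //; lia.
have [x [y [xy Px Py d]]] := IH s' ds' Ps' Pt.
exists x, y; split=> //.
have := dtri s s' x; have := dtri s x t; have := dtri x y t.
by rewrite (adj_dist conM ss') (adj_dist conM xy); lia.
Qed.

(** A geodesic leaving the halfspace does so across an edge that bounds it;
    its end, being in the halfspace, could have been reached faster from the
    near endpoint of that edge. *)
Lemma halfspace_convex a b p q t : adj a b -> side a b p -> side a b q ->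
  dist p q = dist p t + dist t q -> side a b t.
Proof.
move=> ab sp sq d; apply/negPn/negP => st.
have [x [y [xy sx sy e]]] := geodesic_exit sp st.
have : side x y q by rewrite (ladder_side ab).
by rewrite /side; have := dtri p x q; have := dtri y t q; lia.
Qed.

Definition frontier a b x := side a b x /\ exists2 y, adj x y & ~~ side a b y.

(** The quadrangle condition transports the edge [pp'] leaving the halfspace
    along [pr]: the new vertex [m] is outside because the complementary
    halfspace is convex. *)
Lemma frontier_step a b p q r : adj a b -> frontier a b p -> frontier a b q ->
  adj p r -> dist p q = (dist r q).+1 -> frontier a b r.
Proof.
move=> ab [sp [p' pp' sp']] [sq [q' qq' sq']] pr d.
have ba : adj b a by rewrite adj_sym.
have sr : side a b r.
  by apply: (halfspace_convex ab sp sq); rewrite (adj_dist conM pr).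
have e1 : dist p q' = (dist r q).+2.
  have := side_dist p qq'; rewrite (ladder_side ab) // sp.
  by rewrite !(dC _ p) d.
have e2 : dist r q' = (dist r q).+1.
  by have := side_dist r qq'; rewrite (ladder_side ab) // sr !(dC _ r).
have e3 : dist p' q' = (dist r q).+1.
  by have := side_dist q' pp'; rewrite (ladder_side ab) // (negbTE sq'); lia.
have p'r : p' <> r by move=> e; move: sp'; rewrite e sr.
have [m [p'm rm dm]] := quadrangle pp' pr p'r e3 e2 e1.
split=> //; exists m => //; rewrite -(sideN _ ab).
apply: (halfspace_convex (p := p') (q := q') ba); rewrite ?(sideN _ ab) //.
by rewrite (adj_dist conM p'm); lia.
Qed.

Lemma frontier_convex a b p q t : adj a b -> frontier a b p -> frontier a b q ->
  dist p q = dist p t + dist t q -> frontier a b t.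
Proof.
move=> ab + fq; move e: (dist p t) => n.
elim: n p e => [|n IH] p e fp d; first by rewrite -(dist_eq0 conM e).
have [r pr dr] := dist_step conM e.
have := dtri p r q; have := dtri r t q; rewrite (adj_dist conM pr) => h1 h2.
apply: (IH r) => //; last by lia.
by apply: (frontier_step ab fp fq pr); lia.
Qed.

(** A vertex of an edge [pp'] leaving the halfspace is replaced by the endpoint
    inside it.  This reduces convexity of a carrier, which has vertices on both
    sides, to that of the frontier. *)
Lemma frontier_nearest a b p p' : adj a b -> adj p p' ->
    side a b p != side a b p' ->
  exists2 r, frontier a b r
    & forall z, side a b z -> dist p z = dist r z + ~~ side a b p.
Proof.
move=> ab pp'; case sp: (side a b p).
  case sp': (side a b p') => // _.
  exists p; last by move=> z _; rewrite addn0.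
  by split=> //; exists p'; rewrite ?sp'.
case sp': (side a b p') => // _.
have p'p : adj p' p by rewrite adj_sym.
exists p'; first by split=> //; exists p; rewrite ?sp.
move=> z sz; have := side_dist z p'p.
by rewrite (ladder_side ab p'p sp') ?sp // sz => ->; rewrite addn1.
Qed.

(** * Theta-classes and their carriers *)

Lemma eq_pair (a b x y : M) : [set a; b] = [set x; y] ->
  (a = x /\ b = y) \/ (a = y /\ b = x).
Proof.
move=> e.
have ha : [set x; y] a by rewrite -e; left.
have hb : [set x; y] b by rewrite -e; right.
have hx : [set a; b] x by rewrite e; left.
have hy : [set a; b] y by rewrite e; right.
by case: ha hb hx hy => /= -> [] /= -> [] /= ? [] /= ?; auto.
Qed.

(** The two distances from a vertex to the ends of an edge differ by exactly
    one, so the two sums in Theta agree when [x] and [y] are on the same side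
    of [ab], and differ by two otherwise. *)
Lemma Theta_side a b x y : adj a b -> adj x y ->
  Theta [set a; b] [set x; y] <-> side a b x != side a b y.
Proof.
move=> ab xy; have := side_dist x ab; have := side_dist y ab => hy hx.
split=> [[a' [b' [x' [y' [a'b' x'y' /eq_pair e1 /eq_pair e2 ne]]]]]|ne].
  by move: ne hx hy; case: e1 => -[-> ->]; case: e2 => -[-> ->];
     case: (side _ _ _); case: (side _ _ _) => //=; lia.
exists a, b, x, y; split=> //; move: ne hx hy.
by case: (side a b x); case: (side a b y) => //= _; lia.
Qed.

Implicit Types C D : Cross M.

Lemma class_inhabited C : exists u v, adj u v /\ val C [set u; v].
Proof.
have /set_mem [f fE Cf] := valP C; move: (fE) => /set_mem [u [v [uv fuv]]].
exists u, v; split=> //; rewrite Cf -fuv; split=> //.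
by rewrite fuv; apply/Theta_side; rewrite // side_self // side_other.
Qed.

Lemma edge_class u v : adj u v -> exists D : Cross M, val D [set u; v].
Proof.
move=> uv.
have fE : [set u; v] \in @edges M by apply/mem_set; exists u, v.
have h : [set g | g \in @edges M /\ Theta [set u; v] g] \in @Theta_classes M.
  by apply/mem_set; exists [set u; v].
exists (SigSub h : Cross M); split=> //.
by apply/Theta_side; rewrite // side_self // side_other.
Qed.

(** Any edge of a class describes the whole class: this is transitivity of
    Theta. *)
Lemma class_side u v x y D : adj u v -> val D [set u; v] -> adj x y ->
  val D [set x; y] <-> side u v x != side u v y.
Proof.
move=> uv Duv xy.
have /set_mem [f fE Df] := valP D; move: (fE) => /set_mem [a [b [ab fab]]].
move: Duv; rewrite Df fab => -[_ /(Theta_side ab uv)/(cut_side ab uv) <-].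
have xyE : [set x; y] \in @edges M by apply/mem_set; exists x, y.
by split=> [[_] /(Theta_side ab xy)|ne] //; split=> //; apply/(Theta_side ab xy).
Qed.

Lemma class_edges D f : val D f -> exists x y, adj x y /\ f = [set x; y].
Proof. by have /set_mem [g _ ->] := valP D => -[/set_mem]. Qed.

Lemma class_eq u v C D : adj u v -> val C [set u; v] -> val D [set u; v] -> C = D.
Proof.
move=> uv Cuv Duv; apply: val_inj; apply/seteqP; split=> f fX;
  have [x [y [xy e]]] := class_edges fX; move: fX; rewrite e.
- by move/(class_side uv Cuv xy)/(class_side uv Duv xy).
- by move/(class_side uv Duv xy)/(class_side uv Cuv xy).
Qed.

Definition carrier C x := exists2 y, adj x y & val C [set x; y].

(** After choosing the side containing [t], all distances involved are measured
    inside one frontier. *)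
Lemma carrier_convex C p q t : carrier C p -> carrier C q ->
  dist p q = dist p t + dist t q -> carrier C t.
Proof.
move=> [p' pp' Cp] [q' qq' Cq] d.
have [a [b [ab Cab st]]] : exists a b, [/\ adj a b, val C [set a; b] & side a b t].
  have [a [b [ab Cab]]] := class_inhabited C.
  case st: (side a b t); first by exists a, b.
  by exists b, a; rewrite adj_sym setUC (sideN _ ab) st.
move: Cp Cq => /(class_side ab Cab pp') sp /(class_side ab Cab qq') sq.
have [r fr dr] := frontier_nearest ab pp' sp.
have [s fs ds] := frontier_nearest ab qq' sq.
have [st' [t' tt' nst']] : frontier a b t.
  apply: (frontier_convex ab fr fs).
  have := dr _ st; have := ds _ st; have := dr _ fr.1; have := ds _ fs.1.
  rewrite !distxx (dC t s).
  have := dtri p r q; have := dtri r s q; have := dtri r t s.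
  by rewrite (dC q s) (dC q t) (dC t s); lia.
by exists t' => //; apply/(class_side ab Cab tt'); rewrite st' (negbTE nst').
Qed.

End MedianGraph.

(** * Moving towards a carrier *)

Section CarrierDistance.
Variable M : graph.
Hypothesis medM : median_graph M.
Implicit Types a b p q s t u v w x y z : M.
Implicit Types C D : Cross M.

Let conM : connected_graph M := medM.1.
Let dC := distC conM.
Let dtri := dist_triangle conM.

Lemma carrier_edge u v D : adj u v -> val D [set u; v] ->
  carrier D u /\ carrier D v.
Proof.
move=> uv Duv; split; first by exists v.
by exists u; [rewrite adj_sym | rewrite setUC].
Qed.

Lemma carrier_reachable C u :
  exists n, `[< exists2 x, carrier C x & dist u x = n >].
Proof.
have [x [y [xy Cxy]]] := class_inhabited medM C.
by exists (dist u x); apply/asboolP; exists x => //; exists y.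
Qed.

Definition cdist C u := ex_minn (carrier_reachable C u).

Lemma cdist_attained C u : exists2 x, carrier C x & dist u x = cdist C u.
Proof. by rewrite /cdist; case: ex_minnP => n /asboolP. Qed.

Lemma cdist_le C u x : carrier C x -> cdist C u <= dist u x.
Proof.
move=> Cx; rewrite /cdist; case: ex_minnP => n _; apply.
by apply/asboolP; exists x.
Qed.

Lemma cdist_eq0 C u : cdist C u = 0 -> carrier C u.
Proof.
move=> d0; have [x Cx] := cdist_attained C u.
by rewrite d0 => /(dist_eq0 conM) ->.
Qed.

Lemma cdist0 C u : carrier C u -> cdist C u = 0.
Proof. by move=> /(cdist_le u); rewrite distxx leqn0 => /eqP. Qed.

(** A nearest point of a carrier is a gate: the median of [u], [x] and [w]
    lies in the carrier and is no farther from [u] than [x]. *)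
Lemma carrier_gate C u x w : carrier C x -> dist u x = cdist C u ->
  carrier C w -> dist u w = dist u x + dist x w.
Proof.
move=> Cx dx Cw; have [m [[h1 h2 h3] _]] := medM.2 u x w.
have Cm : carrier C m by apply: (carrier_convex medM Cx Cw).
have xm : dist x m = 0.
  by have := cdist_le u Cm; have := dC x m; lia.
by rewrite h2 -(dist_eq0 conM xm).
Qed.

(** The edge [uv] is seen from [u]; thus [beyond v u C] means that [C] lies
    behind it. *)
Definition beyond u v C := forall x, carrier C x -> side v u x.

(** The first edge of a geodesic from [u] to its gate separates [u] from the
    whole carrier. *)
Lemma separating_edge C u : ~ carrier C u ->
  exists v, [/\ adj u v, beyond u v C & cdist C v < cdist C u].
Proof.
move=> nCu; have [x Cx dx] := cdist_attained C u.
case e: (cdist C u) => [|n]; first by case: nCu; apply: cdist_eq0.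
have [v uv dv] : exists2 z, adj u z & dist z x = n by apply: (dist_step conM); lia.
exists v; split=> //; last by have := cdist_le v Cx; lia.
move=> w Cw; have := carrier_gate Cx dx Cw.
by rewrite /side; have := dtri v x w; lia.
Qed.

(** If a vertex [w] of the carrier lies beyond the edge [uv], then the median
    of [v], [w] and the gate of [u] shows that [v] is not farther from the
    carrier than [u]. *)
Lemma cdist_step_le C u v : adj u v -> ~ beyond v u C -> cdist C v <= cdist C u.
Proof.
move=> uv nb; have [x Cx dx] := cdist_attained C u.
have [w Cw sw] : exists2 w, carrier C w & ~~ side u v w.
  apply/not_exists2P => h; apply: nb => w Cw.
  by case: (h w) => // /negP/negPn.
have := side_dist medM w uv; rewrite (negbTE sw) => du.
have [m [[h1 h2 h3] _]] := medM.2 v x w.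
have Cm : carrier C m by apply: (carrier_convex medM Cx Cw).
have := cdist_le v Cm; have := carrier_gate Cx dx Cw.
have := dtri v u x; rewrite (dC v u) (adj_dist conM uv) (dC m x) in h1 *.
by rewrite dx in h1 *; lia.
Qed.

(** Opposite edges of a square belong to the same class, so a class meeting the
    square is carried by each of its vertices. *)
Lemma square_carrier a b c d C f : square a b c d -> val C f ->
  square_edges a b c d f -> carrier C a.
Proof.
move=> /and5P[ab bc cd da /and3P[/eqP ac /eqP bd _]] Cf.
have [ba cb dc ad] : [/\ adj b a, adj c b, adj d c & adj a d].
  by split; rewrite adj_sym.
(* An edge of the square that misses [a] is opposite to one that contains it. *)
have opp x y y' x' : adj x y -> adj y y' -> adj y' x' -> adj x' x ->
    x <> y' -> y <> x' -> val C [set x; y] -> val C [set y'; x'].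
  move=> xy yy' y'x' x'x xy' yx' Cxy; apply/(class_side medM xy Cxy y'x').
  have x'y' : adj x' y' by rewrite adj_sym.
  rewrite !(square_side medM _ xy yy' y'x' x'x xy' yx').
  by rewrite (side_self medM x'y') side_other.
case=> [[[]|]|] e; rewrite e in Cf.
- by exists b.
- by exists d => //; rewrite setUC; apply: (opp b c d a) => //; apply: nesym.
- by exists b => //; apply: (opp c d a b) => //; apply: nesym.
- by exists d => //; rewrite setUC.
Qed.

Lemma square_rot a b c d : square a b c d -> square b c d a.
Proof.
move=> /and5P[ab bc cd da /and4P[ac bd nac nbd]].
by apply/and5P; split=> //; rewrite bd (eq_sym c) ac nbd adj_sym nac.
Qed.

Lemma square_edges_rot a b c d f :
  square_edges a b c d f -> square_edges b c d a f.
Proof.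
by case=> [[[]|]|] e; [right | left; left; left | left; left; right | left; right].
Qed.

Lemma square_carriers a b c d C f : square a b c d -> val C f ->
  square_edges a b c d f -> [/\ carrier C a, carrier C b, carrier C c & carrier C d].
Proof.
move=> sq Cf fS.
have [sq1 fS1] := (square_rot sq, square_edges_rot fS).
have [sq2 fS2] := (square_rot sq1, square_edges_rot fS1).
have [sq3 fS3] := (square_rot sq2, square_edges_rot fS2).
by split; [apply: square_carrier sq Cf fS | apply: square_carrier sq1 Cf fS1
  | apply: square_carrier sq2 Cf fS2 | apply: square_carrier sq3 Cf fS3].
Qed.

(** Crossing is stronger than having a common vertex in the carriers: an edge of
    [D] runs inside the carrier of [C]. *)
Lemma cross_edge C D : adj C D ->
  exists s t, [/\ adj s t, val D [set s; t], carrier C s & carrier C t].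
Proof.
move=> /asboolP[_ [a [b [c [d [sq [f [Cf fS]] [g [Dg gS]]]]]]]].
have [Ca Cb Cc Cd] := square_carriers sq Cf fS.
move: sq gS => /and5P[ab bc cd da _] [[[]|]|] e; rewrite e in Dg.
- by exists a, b.
- by exists b, c.
- by exists c, d.
- by exists d, a.
Qed.

Lemma cross_carrier C D : adj C D -> exists2 x, carrier C x & carrier D x.
Proof.
move=> /cross_edge[s [t [st Dst Cs _]]].
by exists s => //; case: (carrier_edge st Dst).
Qed.

Lemma beyond_not_behind u v C D : adj u v -> adj C D -> beyond u v C ->
  ~ beyond v u D.
Proof.
move=> uv CD bC bD; have [x Cx Dx] := cross_carrier CD.
by have := bC _ Cx; rewrite (sideN medM _ uv) (bD _ Dx).
Qed.

Lemma beyond_not_self u v D : adj u v -> val D [set u; v] -> ~ beyond u v D.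
Proof.
move=> uv Duv /(_ u (carrier_edge uv Duv).1).
by rewrite side_other // adj_sym.
Qed.

(** When the carrier of [C] meets both sides of the edge [uv], a geodesic
    inside this carrier crosses the class [D] of [uv] along an edge [st]; the
    edges of [C] at [s] and [t] complete it to a square. *)
Lemma not_separated_cross u v C D : adj u v -> val D [set u; v] -> C <> D ->
  ~ beyond u v C -> ~ beyond v u C -> adj D C.
Proof.
move=> uv Duv CD nb nb'.
have [p Cp sp] : exists2 p, carrier C p & side u v p.
  apply/not_exists2P => h; apply: nb => w Cw.
  by rewrite (sideN medM _ uv); case: (h w) => // /negP.
have [q Cq sq] : exists2 q, carrier C q & ~~ side u v q.
  apply/not_exists2P => h; apply: nb' => w Cw.
  by case: (h w) => // /negP/negPn.
have [s [t [st ss nst e]]] := geodesic_exit medM sp sq.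
have := dtri p s q; have := dtri s t q; rewrite (adj_dist conM st) => h1 h2.
have Cs : carrier C s by apply: (carrier_convex medM Cp Cq); lia.
have Ct : carrier C t.
  apply: (carrier_convex medM Cp Cq).
  by have := dtri p s t; have := dtri p t q; rewrite (adj_dist conM st); lia.
have Dst : val D [set s; t] by apply/(class_side medM uv Duv st); rewrite ss.
have nCst : ~ val C [set s; t].
  by move=> Cst; apply: CD; apply: (class_eq medM st).
have [a [b [ab Cab sa]]] : exists a b, [/\ adj a b, val C [set a; b] & side a b s].
  have [a [b [ab Cab]]] := class_inhabited medM C.
  case sa: (side a b s); first by exists a, b.
  by exists b, a; rewrite adj_sym setUC (sideN medM _ ab) sa.
have ta : side a b t.
  by apply/negPn/negP => n; apply: nCst; apply/(class_side medM ab Cab st); rewrite sa.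
have [s' ss' Css'] := Cs; have [t' tt' Ctt'] := Ct.
have ns' : ~~ side a b s' by move/(class_side medM ab Cab ss'): Css'; rewrite sa.
have nt' : ~~ side a b t' by move/(class_side medM ab Cab tt'): Ctt'; rewrite ta.
have lad x y z : adj x y -> side a b x -> ~~ side a b y -> side x y z = side a b z.
  by move=> xy sx sy; apply: (ladder_side medM ab).
have s't' : adj s' t'.
  apply: (dist_eq1 conM).
  have := side_dist medM t ss'; rewrite lad // ta.
  have := side_dist medM s' tt'; rewrite lad // (negbTE ns').
  by have := adj_dist conM st; have := dC t' s'; have := dC t s'; lia.
apply/asboolP; split; first by move=> /val_inj/esym.
have ts : adj t s by rewrite adj_sym.
have s's : adj s' s by rewrite adj_sym.
have t's' : adj t' s' by rewrite adj_sym.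
exists s, t, t', s'; split; last 2 first.
- by exists [set s; t]; split=> //; left; left; left.
- by exists [set t; t']; split=> //; left; left; right.
have st' : s <> t' by move=> e'; move: nt'; rewrite -e' sa.
have ts' : t <> s' by move=> e'; move: ns'; rewrite -e' ta.
rewrite /square st tt' t's' s's /=; apply/and4P; split; try exact/eqP.
- by apply/negP => /(adj_dist conM); rewrite (dist_fork medM ts tt').
- by apply/negP => /(adj_dist conM); rewrite (dist_fork medM st ss').
Qed.

End CarrierDistance.

(** * Shortest cycles *)

Section CycleSurgery.
Variable X : graph.
Implicit Types (x y D : X) (c : seq X).

Definition shortest_cycle c :=
  is_cycle c /\ forall c', is_cycle c' -> size c <= size c'.

(** Routing a cycle through [D] instead of the arc [s3] gives a cycle that is
    too short unless [s3] is a single vertex. *)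
Lemma shortest_cycle_detour D x s1 a s3 b s4 :
    shortest_cycle (x :: s1 ++ a :: s3 ++ b :: s4) ->
    D \notin x :: s1 -> D \notin s4 -> s3 != [::] ->
    D = a \/ adj D a -> D = b \/ adj D b ->
  size s3 = 1 /\ is_cycle (D :: b :: s4 ++ x :: s1 ++ [:: a]).
Proof.
move=> [/and3P[_ uc cc] short] Dxs1 Ds4 s3n Da Db.
set c1 := b :: s4 ++ x :: s1 ++ [:: a].
have szc1 : size c1 = (size s1 + size s4).+3.
  by rewrite /c1 /= !size_cat /= size_cat /=; clear; lia.
have uc1 : uniq c1.
  have : subseq (x :: s1 ++ a :: b :: s4) (x :: s1 ++ a :: s3 ++ b :: s4).
    by rewrite /= eqxx cat_subseq //= eqxx suffix_subseq.
  move/subseq_uniq/(_ uc); rewrite (_ : c1 = (b :: s4) ++ (x :: s1 ++ [:: a])) //.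
  by rewrite uniq_catC /= -catA.
have pc1 : path (@adj X) b (s4 ++ x :: s1 ++ [:: a]).
  move: cc; rewrite /= rcons_cat rcons_cons rcons_cat rcons_cons -cats1.
  rewrite !(cat_path, cat_cons) /= !cat_path /= !cat_path /=.
  by case/and5P => -> -> _ _ /and3P[-> -> _].
have sizeE : size c1 + size s3 = size (x :: s1 ++ a :: s3 ++ b :: s4).
  by rewrite szc1 /= !size_cat /= size_cat /=; clear; lia.
(* A chord [ba] would already close up a cycle shorter than the given one. *)
have ba : ~~ adj b a.
  apply/negP => ba; suff /short : is_cycle c1.
    by rewrite -sizeE -[leqRHS]addn0 leq_add2l leqNgt lt0n size_eq0 s3n.
  apply/and3P; split=> //; first by rewrite szc1.
  by rewrite /= rcons_path pc1 !last_cat /= last_cat /= adj_sym.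
have ab : a != b.
  by apply: contraTneq uc1; rewrite /c1 => ->; rewrite /= mem_cat inE mem_cat mem_seq1 eqxx !orbT.
(* If [D] were [a] or [b], it would provide this chord. *)
have {}Da : adj D a /\ D != a.
  case: Da => [e|Da]; last by split=> //; apply: contraTneq Da => ->; rewrite adj_irr.
  case: Db => [e'|]; first by move: ab; rewrite -e e' eqxx.
  by rewrite e adj_sym (negbTE ba).
have {}Db : adj D b /\ D != b.
  case: Db => [e|Db]; last by split=> //; apply: contraTneq Db => ->; rewrite adj_irr.
  by case: Da; rewrite e (negbTE ba).
have cyc : is_cycle (D :: c1).
  apply/and3P; split; first by rewrite [size _](congr1 S szc1).
  - rewrite /= in uc1 *; rewrite uc1 andbT /c1 inE !mem_cat inE mem_cat inE.
    by move: Dxs1 Da.2 Db.2 Ds4; rewrite inE !negb_or => /andP[-> ->] -> -> ->.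
  - rewrite /= rcons_path pc1 !last_cat /= last_cat /= Db.1 adj_sym.
    by case: Da.
have sz : size (D :: c1) = size c1 + 1 by rewrite addn1.
split=> //; have := short _ cyc; rewrite -sizeE sz leq_add2l.
by move: s3n; rewrite -size_eq0; case: (size s3) => [|[]].
Qed.

End CycleSurgery.

Lemma shortest_cycle_exists (X : graph) (c : seq X) : is_cycle c ->
  exists c' : seq X, shortest_cycle c'.
Proof.
move=> cc.
have ex : exists n, `[< exists2 c' : seq X, is_cycle c' & size c' = n >].
  by exists (size c); apply/asboolP; exists c.
case: (ex_minnP ex) => n /asboolP[c' cc' <-] min; exists c'; split=> // d cd.
by apply: min; apply/asboolP; exists d.
Qed.

Lemma split_first (T : Type) (P : pred T) s : has (predC P) s ->
  exists s1 a s2, [/\ s = s1 ++ a :: s2, ~~ P a & all P s1].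
Proof.
elim: s => // x s IH /=; case Px: (P x) => /=; last first.
  by exists [::], x, s; rewrite Px.
by move=> /IH[s1 [a [s2 [-> Pa s1P]]]]; exists (x :: s1), a, s2; rewrite /= Px.
Qed.

Lemma split_last (T : Type) (P : pred T) s : has (predC P) s ->
  exists s1 b s2, [/\ s = s1 ++ b :: s2, ~~ P b & all P s2].
Proof.
rewrite -has_rev => /split_first[s1 [b [s2 [e Pb s1P]]]].
exists (rev s2), b, (rev s1); rewrite all_rev; split=> //.
by rewrite -[s]revK e rev_cat rev_cons cat_rcons.
Qed.

Lemma ltn_sum_seq (I : eqType) (r : seq I) (F G : I -> nat) i : i \in r ->
    {in r, forall j, F j <= G j} -> F i < G i ->
  \sum_(j <- r) F j < \sum_(j <- r) G j.
Proof.
move=> ir le lt; rewrite !(big_rem i ir) /= -addSn leq_add //.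
by rewrite big_seq [leqRHS]big_seq leq_sum // => j /mem_rem/le.
Qed.

(** * Vertices carrying a clique or a shortest cycle *)

Section Descent.
Variable M : graph.
Hypothesis medM : median_graph M.
Implicit Types (u v : M) (C D : Cross M) (c : seq (Cross M)).

Let pot u c := \sum_(C <- c) cdist medM C u.

Let pot_cons u C c : pot u (C :: c) = cdist medM C u + pot u c.
Proof. exact: big_cons. Qed.

Let pot_cat u c c' : pot u (c ++ c') = pot u c + pot u c'.
Proof. exact: big_cat. Qed.

Let pot_lt u v c C : adj u v -> C \in c -> cdist medM C v < cdist medM C u ->
  {in c, forall E, ~ beyond v u E} -> pot v c < pot u c.
Proof.
move=> uv Cc lt nb; apply: (ltn_sum_seq Cc) => // E /nb.
exact: cdist_step_le.
Qed.

Let all_carried u c :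
  {in c, forall C, carrier C u} \/ exists2 C, C \in c & ~ carrier C u.
Proof.
case: (pselect (exists2 C, C \in c & ~ carrier C u)) => [|n]; first by right.
by left=> C Cc; apply: contrapT => nC; apply: n; exists C.
Qed.

Let nonbehind u v C D : adj u v -> beyond u v C -> C = D \/ adj C D ->
  ~ beyond v u D.
Proof.
move=> uv bC [<- bC'|CD]; last exact: beyond_not_behind bC.
have [x Cx _] := cdist_attained medM C u.
by have := bC _ Cx; rewrite (sideN medM _ uv) (bC' _ Cx).
Qed.

(** The classes crossing a class beyond [uv] are not behind [uv], so the
    sum [pot] decreases until every class of the clique is carried. *)
Lemma clique_common_carrier c : {in c &, forall C D, C != D -> adj C D} ->
  exists v, {in c, forall C, carrier C v}.
Proof.
move=> cl; have [u _] := medM.1.1.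
have [n] := ubnP (pot u c); elim: n u => // n IH u lt.
have [all_u|[C Cc nCu]] := all_carried u c; first by exists u.
have [v [uv bC ltC]] := separating_edge medM nCu.
apply: (IH v); apply: leq_trans (pot_lt uv Cc ltC _) lt => D Dc.
apply: nonbehind bC _ => //.
by have [->|ne] := eqVneq C D; [left | right; apply: cl].
Qed.

(** Either no class of [c] is behind [uv] and only the vertex moves, or the
    class [E] behind [uv] is replaced by the class [D] of [uv].  The arcs of the
    cycle from [C] to [E] are followed in both directions up to the first class
    that is not beyond [uv]: these are [a] and [b]. *)
Lemma cycle_descent u c C : shortest_cycle c -> C \in c -> ~ carrier C u ->
  exists v c', [/\ is_cycle c', size c' = size c & pot v c' < pot u c].
Proof.
move=> shc Cc nCu; have [v [uv bC ltC]] := separating_edge medM nCu.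
case: (pselect (exists2 E, E \in c & beyond v u E)) => [[E Ec bE]|nb]; last first.
  exists v, c; split=> //; first by case: shc.
  by apply: (pot_lt uv Cc ltC) => E Ec bE; apply: nb; exists E.
have [D Duv] := edge_class medM uv.
have [i s ce] := rot_to Cc.
have shs : shortest_cycle (C :: s).
  by rewrite -ce; split; rewrite /is_cycle ?size_rot ?rot_uniq ?rot_cycle; case: shc.
have potE : pot u c = pot u (C :: s) by apply: perm_big; rewrite -ce perm_sym perm_rot.
have sizeE : size c = size (C :: s) by rewrite -ce size_rot.
have {}Ec : E \in C :: s by rewrite -ce mem_rot.
rewrite potE sizeE {c potE shc Cc ce sizeE}.
pose B F := `[< beyond u v F >].
have nB : ~~ B E.
  by apply/asboolPn => bE'; apply: nonbehind bE' _ bE => //; left.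
have BC : B C by apply/asboolP.
(* A class that is neither beyond nor behind the edge is [D] or crosses it. *)
have near F F' : B F -> adj F F' -> ~~ B F' ->
    [/\ D = F' \/ adj D F', ~ beyond v u F' & F' != E].
  move=> /asboolP bF FF' /asboolPn nbF'.
  have nbF : ~ beyond v u F' by apply: nonbehind bF _ => //; right.
  split=> //; last by apply: contra_not_neq nbF => ->.
  have [->|/eqP ne] := eqVneq F' D; first by left.
  by right; apply: (not_separated_cross medM uv Duv ne).
have Es : E \in s.
  by move: Ec; rewrite inE => /orP[/eqP e|//]; move: nB; rewrite e BC.
have [s1 [a [s2 [se na s1B]]]] : exists s1 a s2,
    [/\ s = s1 ++ a :: s2, ~~ B a & all B s1].
  by apply: split_first; apply/hasP; exists E.
have cyc : cycle (@adj (Cross M)) (C :: s) by case: shs => /and3P[].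
have [Da nba aE] : [/\ D = a \/ adj D a, ~ beyond v u a & a != E].
  apply: (near (last C s1)) => //.
    have : last C s1 \in C :: s1 by apply: mem_last.
    by rewrite inE => /orP[/eqP ->//|/(allP s1B)].
  by move: cyc; rewrite /= se rcons_cat cat_path /= => /and3P[].
have Es2 : E \in s2.
  move: Es; rewrite se mem_cat inE eq_sym (negbTE aE) /= => /orP[|//].
  by move/(allP s1B); rewrite (negbTE nB).
have [s3 [b [s4 [s2e nb s4B]]]] : exists s3 b s4,
    [/\ s2 = s3 ++ b :: s4, ~~ B b & all B s4].
  by apply: split_last; apply/hasP; exists E.
rewrite s2e in se Es2 => {s2 s2e}.
have [Db nbb bE'] : [/\ D = b \/ adj D b, ~ beyond v u b & b != E].
  apply: (near (head C s4)) => //.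
    by case: (s4) s4B => //= F s4' /andP[].
  move: cyc; rewrite /= se rcons_cat cat_path rcons_cons /= rcons_cat cat_path rcons_cons /=.
  by case/and5P => _ _ _ _; rewrite cross_adj_sym; case: (s4) => [|F s4'] /= /andP[].
have Es3 : E \in s3.
  move: Es2; rewrite mem_cat inE eq_sym (negbTE bE') /= => /orP[//|].
  by move/(allP s4B); rewrite (negbTE nB).
have nBD : ~~ B D by apply/asboolPn; apply: beyond_not_self.
have [s3_1 cyc'] : size s3 = 1 /\ is_cycle (D :: b :: s4 ++ C :: s1 ++ [:: a]).
  apply: shortest_cycle_detour => //; first by rewrite -se.
  - rewrite inE; apply/norP; split; first by apply: contraNneq nBD => ->.
    by apply: contra nBD => /(allP s1B).
  - by apply: contra nBD => /(allP s4B).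
  - by apply: contraTneq Es3 => ->.
(* The class [D] is carried by [v] and costs nothing there, the class it
   replaces costs at least nothing at [u], and [C] brings the strict decrease. *)
have dle F : ~ beyond v u F -> cdist medM F v <= cdist medM F u.
  by move=> nbF; apply: cdist_step_le.
have potle t : all B t -> pot v t <= pot u t.
  move=> tB; rewrite /pot !big_seq leq_sum // => F /(allP tB) /asboolP bF.
  by apply: dle; apply: nonbehind bF _ => //; left.
exists v, (D :: b :: s4 ++ C :: s1 ++ [:: a]); split=> //.
  by rewrite se /= !size_cat /= !size_cat /= s3_1; clear; lia.
rewrite se !(pot_cat, pot_cons) [pot v [::]]big_nil.
rewrite (cdist0 medM (carrier_edge uv Duv).2).
move: (potle _ s1B) (potle _ s4B) (dle _ nba) (dle _ nbb) ltC.
by clear; lia.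
Qed.

Lemma shortest_cycle_common_carrier c : shortest_cycle c ->
  exists v c', is_cycle c' /\ {in c', forall C, carrier C v}.
Proof.
move=> shc; have [u _] := medM.1.1.
have [n] := ubnP (pot u c); elim: n u c shc => // n IH u c shc lt.
have [all_u|[C Cc nCu]] := all_carried u c.
  by exists u, c; split=> //; case: shc.
have [v [c' [cyc' sz lt']]] := cycle_descent shc Cc nCu.
have shc' : shortest_cycle c' by split=> // d; rewrite sz; apply: shc.2.
exact: (IH v c' shc' (leq_trans lt' lt)).
Qed.

End Descent.

(** * Lower bounds on the median degree *)

Section Counting.
Variables (R : realType) (T : choiceType).
Implicit Types (A : set T) (s : seq T).
Local Open Scope ereal_scope.

Lemma counting_ge A s : uniq s -> {in s, forall x, A x} ->
  (size s)%:R%:E <= counting A :> \bar R.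
Proof.
move=> us sA; rewrite /counting; case: asboolP => [finA|_]; last exact: leey.
rewrite lee_fin ler_nat; apply: uniq_leq_size => // x xs.
by change (x \in fset_set A); rewrite in_fset_set //; apply/mem_set/sA.
Qed.

(** An infinite set has finite subsets of every size, so bounding finite
    sequences bounds the value [+oo] as well. *)
Lemma counting_le A (r : \bar R) :
  (forall s, uniq s -> {in s, forall x, A x} -> (size s)%:R%:E <= r) ->
  counting A <= r.
Proof.
move=> h; rewrite /counting; case: asboolP => finA.
  apply: h => // x; change (x \in fset_set A -> A x).
  by rewrite in_fset_set // => /set_mem.
suff -> : r = +oo by [].
apply: eq_infty => z; pose n := Num.bound `|z|%R.
have [B BA nB] := infinite_set_fset n finA.
apply: (@le_trans _ _ (n%:R%:E)).
  rewrite lee_fin (le_trans (ler_norm z)) // ltW //.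
  by apply: archi_boundP; apply: normr_ge0.
apply: (@le_trans _ _ (size (finmap.enum_fset B))%:R%:E).
  by rewrite lee_fin ler_nat.
by apply: h => // x xB; apply: BA.
Qed.

End Counting.

Section LowerBounds.
Variable R : realType.
Local Open Scope ereal_scope.

(** Distinct classes use distinct edges at a vertex common to their carriers,
    so their number is at most the degree of this vertex. *)
Lemma carriers_le_degree (M : graph) (v : M) (c : seq (Cross M)) :
    median_graph M -> uniq c -> {in c, forall C, carrier C v} ->
  (size c)%:R%:E <= degree R M.
Proof.
move=> medM uc cv.
have ex C : exists y, C \in c -> adj v y /\ val C [set v; y].
  case: (boolP (C \in c)) => [/cv [y vy Cvy]|]; first by exists y.
  by exists v.
have [f fP] := choice ex.
apply: (@le_trans _ _ (vertex_degree R v)); last first.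
  by apply: ereal_sup_ubound; exists v.
rewrite -(size_map f); apply: counting_ge => [|y /mapP[C Cc ->]]; last first.
  by case: (fP C Cc).
rewrite map_inj_in_uniq // => C D Cc Dc e.
have [vC Cv] := fP C Cc; have [_ Dv] := fP D Dc.
by apply: (class_eq medM vC Cv); rewrite e.
Qed.

Lemma is_cycle_map (X Y : graph) (f : X -> Y) (c : seq X) : injective f ->
  {mono f : x y / adj x y} -> is_cycle (map f c) = is_cycle c.
Proof.
move=> inj_f mono_f; rewrite /is_cycle size_map map_inj_uniq //.
congr [&& _, _ & _]; rewrite (@cycle_map _ _ f).
by case: c => //= x c; apply: eq_path.
Qed.

Lemma clique_number_le_mdeg (X : graph) : clique_number R X <= mdeg R X.
Proof.
apply/ereal_infP => _ [M [medM [f [[g fK gK] mono_f]] ->]].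
apply: ge_ereal_sup => _ [K cK <-]; apply: counting_le => s us sK.
have inj_g : injective g := can_inj gK.
rewrite -(size_map g).
have [|v cv] := @clique_common_carrier M medM (map g s).
  move=> _ _ /mapP[x xs ->] /mapP[y ys ->] /negP ne.
  rewrite -mono_f !gK; apply: cK; [exact: sK|exact: sK|].
  by move=> e; apply: ne; rewrite e.
by apply: carriers_le_degree cv => //; rewrite map_inj_uniq.
Qed.

Lemma girth_le_mdeg (X : graph) : (exists c : seq X, is_cycle c) ->
  girth R X <= mdeg R X.
Proof.
move=> [c cc]; apply/ereal_infP => _ [M [medM [f [[g fK gK] mono_f]] ->]].
have inj_g : injective g := can_inj gK.
have inj_f : injective f := can_inj fK.
have mono_g : {mono g : x y / adj x y} by move=> x y; rewrite -mono_f !gK.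
have [d /(shortest_cycle_common_carrier medM)[v [c' [cc' c'v]]]] :
    exists d : seq (Cross M), shortest_cycle d.
  by apply: (@shortest_cycle_exists _ (map g c)); rewrite (is_cycle_map _ inj_g).
apply: (@le_trans _ _ (size c')%:R%:E).
  apply: ereal_inf_lbound; exists (map f c'); rewrite ?size_map //=.
  by rewrite (is_cycle_map _ inj_f).
by apply: carriers_le_degree c'v => //; case/and3P: cc'.
Qed.

End LowerBounds.

(** * The graph of cliques of a finite graph *)

Section SimplexGraph.
Variables (T : finType) (e : rel T).
Hypotheses (e_sym : symmetric e) (e_irr : irreflexive e).
Implicit Types (A B C : {set T}) (x y z : T).

Let X : graph := Graph e_sym e_irr.

Definition complete_set A := [forall x in A, forall y in A, (x != y) ==> e x y].

Lemma complete_setP A : reflect {in A &, forall x y, x != y -> e x y} (complete_set A).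
Proof.
apply: (iffP forall_inP) => [h x y xA yA xy|h x xA].
  by have /forall_inP/(_ y yA)/implyP/(_ xy) := h x xA.
by apply/forall_inP => y yA; apply/implyP; apply: h.
Qed.

Lemma complete_set0 : complete_set finset.set0.
Proof. by apply/complete_setP => x y; rewrite inE. Qed.

Lemma sub_complete_set A B : A \subset B -> complete_set B -> complete_set A.
Proof.
move=> /fintype.subsetP AB /complete_setP h; apply/complete_setP => x y /AB xB /AB yB.
exact: h.
Qed.

Definition simplex : choiceType := {A : {set T} | complete_set A}.
Definition Simplex A (h : complete_set A) : simplex := exist _ A h.
Implicit Types K L N : simplex.

Definition hamming A B := #|[set x | (x \in A) (+) (x \in B)]%SET|.

Lemma hammingE A B : hamming A B = \sum_x ((x \in A) (+) (x \in B)).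
Proof.
by rewrite /hamming -sum1_card big_mkcond; apply: eq_bigr => x _; rewrite inE; case: (_ (+) _).
Qed.

Lemma hammingC A B : hamming A B = hamming B A.
Proof. by apply: eq_card => x; rewrite !inE addbC. Qed.

Lemma hammingxx A : hamming A A = 0.
Proof. by rewrite hammingE big1 // => x _; rewrite addbb. Qed.

(** The triangle inequality, with its equality case, holds for each element
    separately. *)
Lemma hamming_leqif A B C : hamming A B <= hamming A C + hamming C B
  ?= iff [forall x, ((x \in A) == (x \in B)) ==> ((x \in C) == (x \in A))].
Proof.
rewrite !hammingE -big_split /=; apply: leqif_sum => x _.
by case: (x \in A); case: (x \in B); case: (x \in C).
Qed.

Lemma hamming_flip x A B C : (forall y, (y \in A) (+) (y \in B) = (y == x)) ->
  (x \in B) = (x \in C) -> hamming A C = (hamming B C).+1.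
Proof.
move=> AB BC; rewrite !hammingE (bigD1 x) // [in RHS](bigD1 x) //= BC addbb.
have := AB x; rewrite eqxx BC => -> /=; rewrite add1n; congr _.+1.
apply: eq_bigr => y /negbTE yx; have := AB y; rewrite yx.
by case: (y \in A); case: (y \in B).
Qed.

Lemma hamming0 A B : hamming A B = 0 -> A = B.
Proof.
move/eqP; rewrite cards_eq0 => /eqP h; apply/setP => x.
by have := congr1 (fun D : {set T} => x \in D) h; rewrite !inE; case: (x \in A); case: (x \in B).
Qed.

Definition simplex_adj K L := hamming (val K) (val L) == 1.

Lemma simplex_adj_sym : symmetric simplex_adj.
Proof. by move=> K L; rewrite /simplex_adj hammingC. Qed.

Lemma simplex_adj_irr : irreflexive simplex_adj.
Proof. by move=> K; rewrite /simplex_adj hammingxx. Qed.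

Definition simplex_graph : graph := Graph simplex_adj_sym simplex_adj_irr.
Local Notation S := simplex_graph.

Definition differ_at x K L := forall y, (y \in val K) (+) (y \in val L) = (y == x).

Lemma differ_adj x K L : differ_at x K L -> adj (K : S) L.
Proof.
move=> h; rewrite /= /simplex_adj /hamming (_ : [set _ | _]%SET = [set x]%SET) ?cards1 //.
by apply/setP => y; rewrite !inE h.
Qed.

Lemma adj_differ K L : adj (K : S) L -> exists x, differ_at x K L.
Proof.
move=> /cards1P[x h]; exists x => y.
by have := congr1 (fun D : {set T} => y \in D) h; rewrite !inE.
Qed.

Lemma hamming_bound K L n : walk (K : S) L n -> hamming (val K) (val L) <= n.
Proof.
move=> [p [+ <- <-]]; elim: p K => [|N p IH] K /=.
  by rewrite hammingxx.
move=> /andP[/eqP KN /IH h]; apply: leq_trans (hamming_leqif _ _ (val N)) _.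
by rewrite KN.
Qed.

Lemma simplex_walk K L : walk (K : S) L (hamming (val K) (val L)).
Proof.
move d: (hamming _ _) => n; elim: n K d => [|n IH] K d.
  by exists [::]; split=> //=; apply: val_inj; apply: hamming0.
suff [N [x KN] dN] : exists2 N, (exists x, differ_at x K N) & hamming (val N) (val L) = n.
  have [p [pN lp sp]] := IH N dN; exists (N :: p); split=> //=; last by rewrite sp.
  by rewrite pN andbT; apply: (differ_adj KN).
have key x A : complete_set A ->
    (forall y, (y \in val K) (+) (y \in A) = (y == x)) -> (x \in A) = (x \in val L) ->
  exists2 N, (exists x, differ_at x K N) & hamming (val N) (val L) = n.
  move=> cA KA AL; exists (Simplex cA); first by exists x.
  by apply/eqP; rewrite -eqSS -(hamming_flip KA AL) d.
(* Removing elements first keeps the set complete: elements of [L] are added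
   only once it is contained in [L]. *)
have [sub|/subsetPn[x xK xL]] := boolP (val K \subset val L).
  have [x xL xK] : exists2 x, x \in val L & x \notin val K.
    apply/subsetPn; apply: contra_eqN d => sub'.
    by rewrite (_ : val K = val L) ?hammingxx //; apply/eqP; rewrite finset.eqEsubset sub.
  apply: (key x (x |: val K)%SET); last by rewrite xL setU11.
    by apply: sub_complete_set (valP L); rewrite finset.subUset finset.sub1set xL.
  by move=> y; rewrite in_setU1; have [->|] := eqVneq y x; [rewrite (negbTE xK)|rewrite addbb].
apply: (key x (val K :\ x)%SET); last by rewrite setD11 (negbTE xL).
  by apply: sub_complete_set (valP K); apply: finset.subsetDl.
by move=> y; rewrite in_setD1; have [->|] := eqVneq y x; [rewrite xK|rewrite addbb].
Qed.

Lemma simplex_connected : connected_graph S.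
Proof.
split; last by move=> K L; exists (hamming (val K) (val L)); apply: simplex_walk.
by exists (Simplex complete_set0).
Qed.

Lemma dist_simplex K L : dist (K : S) L = hamming (val K) (val L).
Proof.
apply/eqP; rewrite eqn_leq (dist_le_walk (simplex_walk K L)).
exact/hamming_bound/(walk_dist simplex_connected).
Qed.

Lemma simplex_between K L N :
  dist (K : S) L = dist (K : S) N + dist (N : S) L <->
  (forall x, (x \in val K) = (x \in val L) -> (x \in val N) = (x \in val K)).
Proof.
rewrite !dist_simplex; have := hamming_leqif (val K) (val L) (val N).
move=> [_ eqE]; split=> [/eqP|h].
  by rewrite eqE => /forallP h x xE; have := h x; rewrite xE eqxx => /eqP.
by apply/eqP; rewrite eqE; apply/forallP => x; apply/implyP => /eqP/h ->.
Qed.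

Definition majority A B C := [set x | [|| (x \in A) && (x \in B),
  (x \in A) && (x \in C) | (x \in B) && (x \in C)]]%SET.

(** Two elements of the majority belong together to one of the three sets. *)
Lemma majority_complete A B C : complete_set A -> complete_set B ->
  complete_set C -> complete_set (majority A B C).
Proof.
move=> /complete_setP hA /complete_setP hB /complete_setP hC.
apply/complete_setP => x y; rewrite !inE.
case/or3P => /andP[x1 x2]; case/or3P => /andP[y1 y2] xy;
  by [apply: hA | apply: hB | apply: hC].
Qed.

(** Each of the three equations fixes the membership in the median of the
    elements on which the two cliques agree, and two of three cliques agree on
    any given element. *)
Lemma simplex_median : median_graph S.
Proof.
split; first exact: simplex_connected.
move=> K L N; have h := majority_complete (valP K) (valP L) (valP N).
exists (Simplex h); split.
  by split; apply/simplex_between => x /=; rewrite inE;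
    case: (x \in val K); case: (x \in val L); case: (x \in val N).
move=> Q [/simplex_between h1 /simplex_between h2 /simplex_between h3].
apply: val_inj; apply/setP => x /=; rewrite inE.
move: (h1 x) (h2 x) (h3 x).
by case: (x \in val K); case: (x \in val L); case: (x \in val N) => /=;
  case: (x \in val Q) => // *; intuition.
Qed.

Lemma differ_side x K L N : differ_at x K L ->
  side (K : S) L N = ((x \in val N) == (x \in val K)).
Proof.
move=> KL; rewrite /side !dist_simplex; have := KL x; rewrite eqxx => KLx.
have LK y : (y \in val L) (+) (y \in val K) = (y == x) by rewrite addbC KL.
have [NK|NK] := eqVneq (x \in val N) (x \in val K).
  by rewrite (hamming_flip LK (esym NK)) ltnSn.
rewrite (hamming_flip KL) ?ltnNge ?leqnSn //.
by move: NK KLx; case: (x \in val N); case: (x \in val K); case: (x \in val L).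
Qed.

(** The halfspaces of an edge labelled [x] consist of the cliques containing
    [x] and of those avoiding it, so a class is the set of edges with a given
    label. *)
Lemma class_label (C : Cross S) : exists x, forall K L y, differ_at y K L ->
  (val C [set (K : S); (L : S)] <-> y = x).
Proof.
have [u [v [uv Cuv]]] := class_inhabited simplex_median C.
have [x uvx] := adj_differ uv; exists x => K L y KL.
apply: (iff_trans (class_side simplex_median uv Cuv (differ_adj KL))).
apply: iff_trans (iff_sym (rwP eqP)).
rewrite !(differ_side _ uvx) [y == x]eq_sym -KL.
by case: (x \in val u); case: (x \in val K); case: (x \in val L).
Qed.

Lemma complete_set1 x : complete_set [set x]%SET.
Proof. by apply/complete_setP => y z; rewrite !inE => /eqP-> /eqP->; rewrite eqxx. Qed.

Lemma complete_set2 x y : e x y -> complete_set [set x; y]%SET.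
Proof.
move=> xy; apply/complete_setP => z t; rewrite !inE.
by case/orP => /eqP-> /orP[]/eqP->; rewrite ?eqxx // e_sym.
Qed.

(** Adjacent [x] and [y] label the square with corners [set0], [{x}], [{x, y}]
    and [{y}].  Conversely, crossing classes provide a clique that contains both
    labels, which are therefore adjacent. *)
Lemma cross_simplex : graph_iso (Cross S) X.
Proof.
have [f fP] := choice class_label.
have medS := simplex_median.
have d01 x : differ_at x (Simplex complete_set0) (Simplex (complete_set1 x)).
  by move=> y; rewrite /= !inE.
have inj_f : injective f.
  move=> C D CD; have [u [v [uv Cuv]]] := class_inhabited medS C.
  have [x uvx] := adj_differ uv; apply: (class_eq medS uv Cuv).
  by apply/(fP D _ _ _ uvx); rewrite -CD; apply/(fP C _ _ _ uvx).
have surj_f x : exists D, f D = x.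
  have [D D01] := edge_class medS (differ_adj (d01 x)).
  by exists D; apply/esym/(fP D _ _ _ (d01 x)).
have [g gK] := choice surj_f.
exists f; split; first by exists g => // C; apply: inj_f; rewrite gK.
move=> C D; apply/idP/idP => [xy|CD].
  have C0 : val C [set (Simplex complete_set0 : S); Simplex (complete_set1 (f C))].
    exact/(fP C _ _ _ (d01 _)).
  have D0 : val D [set (Simplex complete_set0 : S); Simplex (complete_set1 (f D))].
    exact/(fP D _ _ _ (d01 _)).
  have neq : f D != f C by apply: contraTneq xy => ->; rewrite adj_irr.
  have d12 : differ_at (f D) (Simplex (complete_set1 (f C))) (Simplex (complete_set2 xy)).
    move=> y; rewrite /= !inE; have [->|] := eqVneq y (f C); last by [].
    by rewrite eq_sym (negbTE neq).
  have D1 := (fP D _ _ _ d12).2 erefl.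
  have C01 := differ_adj (d01 (f C)).
  apply: (not_separated_cross medS C01 C0).
  - by move=> DC; move: neq; rewrite DC eqxx.
  - move=> /(_ (Simplex complete_set0)); rewrite side_other //; last by rewrite adj_sym.
    suff h : carrier D (Simplex complete_set0 : S) by move=> /(_ h).
    by exists (Simplex (complete_set1 (f D))) => //; apply: differ_adj.
  - move=> /(_ (Simplex (complete_set1 (f C)))); rewrite side_other //.
    suff h : carrier D (Simplex (complete_set1 (f C)) : S) by move=> /(_ h).
    by exists (Simplex (complete_set2 xy)) => //; apply: differ_adj d12.
(* The class of [D] has an edge whose two ends are in the carrier of [C]; one
   of them contains [f D], and it or its neighbour across [C] contains both
   labels. *)
have CnD : f C != f D by apply: contraTneq CD => /inj_f ->; rewrite adj_irr.
have [s [t [st Dst Cs Ct]]] := cross_edge medS CD.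
have [z stz] := adj_differ st; have zD := (fP D _ _ _ stz).1 Dst; subst z.
have [K [L [KL CKL DK]]] : exists K L,
    [/\ adj (K : S) L, val C [set (K : S); (L : S)] & f D \in val K].
  have := stz (f D); rewrite eqxx; case sD: (f D \in val s) => /= tD.
    by case: Cs => L; exists s, L.
  by case: Ct => L; exists t, L.
have [z KLz] := adj_differ KL; have zC := (fP C _ _ _ KLz).1 CKL; subst z.
have LD : f D \in val L.
  by have := KLz (f D); rewrite DK eq_sym (negbTE CnD); case: (_ \in val L).
have := KLz (f C); rewrite eqxx; case CK: (f C \in val K) => /= CL.
  by move/complete_setP: (valP K); apply.
by move/complete_setP: (valP L); apply.
Qed.

Lemma mdeg_le_card (R : realType) : (mdeg R X <= #|T|%:R%:E)%E.
Proof.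
apply: ge_ereal_inf; exists (degree R S).
  by exists S; split; [exact: simplex_median | exact: cross_simplex |].
apply: ge_ereal_sup => _ [K _ <-]; apply: counting_le => s us sK.
have [->|[L0 L0s]] : s = [::] \/ exists L0, L0 \in s.
  by case: (s) => [|L0 s']; [left | right; exists L0; rewrite mem_head].
  by rewrite lee_fin ler0n.
have [x0 _] := adj_differ (sK _ L0s).
have ex (L : S) : exists x, adj (K : S) L -> differ_at x K L.
  by case: (boolP (adj (K : S) L)) => [/adj_differ[x ?]|_]; [exists x | exists x0].
have [l lP] := choice ex.
rewrite lee_fin ler_nat -(size_map l) cardE; apply: uniq_leq_size; last first.
  by move=> x _; rewrite mem_enum.
rewrite map_inj_in_uniq // => L N /sK KL /sK KN ll.
apply: val_inj; apply/setP => y.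
have := lP L KL y; have := lP N KN y; rewrite -ll => <-.
by case: (y \in val (K : simplex)); case: (y \in _); case: (y \in _).
Qed.

End SimplexGraph.

(** * Complete graphs and cycles *)

(** The successor acts transitively on the residues modulo [n]. *)
Lemma ordS_closed_full n (P : pred 'I_n) (i : 'I_n) :
  P i -> (forall j, P j -> P (ordS j)) -> forall j, P j.
Proof.
move=> Pi PS j.
have it k : P (iter k (@ordS n) i) by elim: k => //= k; apply: PS.
have itE k : iter k (@ordS n) i = (i + k) %% n :> nat.
  elim: k => [|k IH] /=; first by rewrite addn0 modn_small.
  by rewrite IH -addn1 modnDml addn1 addnS.
have -> // : j = iter (n - i + j) (@ordS n) i.
by apply: val_inj; rewrite /= itE addnA subnKC 1?ltnW // modnDl modn_small.
Qed.

Lemma ordS_neq n (i : 'I_n) : 1 < n -> ordS i != i.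
Proof.
move=> n1; apply/eqP => /(congr1 val) /=.
have [lt|] := ltnP i.+1 n; first by rewrite modn_small //; lia.
move=> le; have e : i.+1 = n by apply/eqP; rewrite eqn_leq le ltn_ord.
by rewrite e modnn => i0; move: n1; rewrite -e -i0.
Qed.

(** A vertex of a cycle of [C_n] has two distinct neighbours on it, hence both
    its neighbours in [C_n]. *)
Lemma cycle_graph_cycle_size n (c : seq (cycle_graph n)) :
  is_cycle c -> n <= size c.
Proof.
move=> /and3P[c3 uc cc].
have closed i : i \in c -> ordS i \in c.
  move=> ic; have [k s cE] := rot_to ic.
  rewrite -(mem_rot k) cE; move: c3 uc cc.
  rewrite -(size_rot k) -(rot_uniq k) -(rot_cycle k) cE.
  case: s {cE} => [|y s] //; case/lastP: s => // s z _.
  rewrite /= rcons_path last_rcons => /and3P[_ + _] /and3P[/andP[_ iy] _ /andP[_ zi]].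
  rewrite mem_rcons !inE negb_or => /andP[yz _].
  case/orP: iy => /eqP iy; first by rewrite iy eqxx orbT.
  case/orP: zi => /eqP zi; last by rewrite zi mem_rcons mem_head !orbT.
  by move: yz; rewrite -(inj_eq (bij_inj (@ordS_bij n))) -iy -zi eqxx.
case: c c3 closed {uc cc} => // i c _ closed.
rewrite -[n in (n <= _)%N]card_ord cardE; apply: uniq_leq_size (enum_uniq _) _ => j _.
exact: (ordS_closed_full (mem_head i c) closed).
Qed.

Lemma cycle_graph_has_cycle n : 2 < n -> exists c : seq (cycle_graph n), is_cycle c.
Proof.
case: n => // m m2; pose c := orbit (@ordS m.+1) ord0; exists c.
have inj_S : injective (@ordS m.+1) := bij_inj (@ordS_bij m.+1).
have closed (i : 'I_m.+1) : i \in c -> ordS i \in c.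
  by rewrite -!fconnect_orbit => h; apply: connect_trans h (fconnect1 _ _).
apply/and3P; split; last 1 first.
- apply: sub_cycle (cycle_orbit inj_S ord0) => i j /eqP <-.
  by rewrite /= /cycle_adj eqxx eq_sym ordS_neq // ltnW.
- apply: leq_trans m2 _; rewrite -[n in (n <= _)%N]card_ord cardE.
  apply: uniq_leq_size (enum_uniq _) _ => j _.
  by apply: (ordS_closed_full (i := ord0)) closed j; rewrite -fconnect_orbit connect0.
- exact: orbit_uniq.
Qed.

Section Values.
Variable R : realType.
Local Open Scope ereal_scope.

Lemma clique_number_ge (X : graph) (s : seq X) : uniq s ->
  {in s &, forall x y, x != y -> adj x y} -> (size s)%:R%:E <= clique_number R X.
Proof.
move=> us cs; apply: (@le_trans _ _ (counting [set` s])); first exact: counting_ge.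
apply: ereal_sup_ubound; exists [set` s] => // x y xs ys /eqP.
exact: cs.
Qed.

Lemma mdeg_complete_graph n : mdeg R (complete_graph n) = n%:R%:E.
Proof.
apply/eqP; rewrite eq_le; apply/andP; split.
  by apply: le_trans (mdeg_le_card _ _ R) _; rewrite card_ord.
apply: le_trans (clique_number_le_mdeg R _).
rewrite -[X in (X%:R)%R]card_ord cardE.
exact: (@clique_number_ge (complete_graph n) _ (enum_uniq 'I_n)).
Qed.

Lemma mdeg_cycle_graph n : mdeg R (cycle_graph n) = n%:R%:E.
Proof.
apply/eqP; rewrite eq_le; apply/andP; split.
  by apply: le_trans (mdeg_le_card _ _ R) _; rewrite card_ord.
have [n2|n3] := leqP n 2.
  (* [C_1] and [C_2] have no cycles, but are complete graphs. *)
  apply: le_trans (clique_number_le_mdeg R _).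
  rewrite -[X in (X%:R)%R]card_ord cardE.
  apply: (@clique_number_ge (cycle_graph n) _ (enum_uniq 'I_n)) => i j _ _ ij.
  rewrite /= /cycle_adj ij /=.
  by case: n n2 i j ij => [|[|[|m]]] //= _ [[|[|i]] ?] // [[|[|j]] ?].
apply: le_trans (girth_le_mdeg R (cycle_graph_has_cycle n3)).
apply/ereal_infP => _ [c cc <-].
by rewrite lee_fin ler_nat; apply: cycle_graph_cycle_size.
Qed.

End Values.

Local Open Scope ereal_scope.

Theorem corollary5p5 (R : realType) :
  (forall X : graph,
      clique_number R X <= mdeg R X /\
      ((exists c : seq X, is_cycle c) -> girth R X <= mdeg R X)) /\
  (forall n : nat, (1 <= n)%N ->
      mdeg R (complete_graph n) = n%:R%:E /\
      mdeg R (cycle_graph n) = n%:R%:E).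
Proof.
split=> [X|n _]; first by split; [apply: clique_number_le_mdeg | apply: girth_le_mdeg].
by split; [apply: mdeg_complete_graph | apply: mdeg_cycle_graph].
Qed.
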